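(* Let $\mathrm{BP}$ be a binary program in $n$ variables with constraints $Ax\leq b$, $x\in\{0,1\}^n$, where $A\in\mathbb{R}^{m\times n}$, $b\in\mathbb{R}^m$. Suppose that there exist $\bar{x},\bar{y}\in\operatorname{Fes}(\mathrm{BP})$ such that $\bar{x}+\bar{y}\leq e$. If $P^{n}_{\mathrm{BP}}$ is full dimensional, then $P^{n}_{\overline{\mathrm{BPD}}}$ is full dimensional, i.e., $\dim P^{n}_{\overline{\mathrm{BPD}}}=3n$.
   Context: $\operatorname{Fes}(\mathrm{BP})=\{x\in\{0,1\}^n: Ax\leq b\}$ and $P^{n}_{\mathrm{BP}}=\operatorname{conv}(\operatorname{Fes}(\mathrm{BP}))\subseteq\mathbb{R}^n$. $e$ is the all-ones vector, inequalities between vectors are entrywise, and $x\oplus y\oplus z$ denotes concatenation. The diameter polytope is $P^{n}_{\overline{\mathrm{BPD}}}=\operatorname{conv}\{x\oplus y\oplus z\in\{0,1\}^{3n}: Ax\leq b,\ Ay\leq b,\ x+y-z\leq e\}\subseteq\mathbb{R}^{3n}$. The dimension of a polytope is the dimension of its affine hull; a polytope $P\subseteq\mathbb{R}^N$ is full dimensional if $\dim P=N$. *)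

(* Defs.v *)
From mathcomp Require Import all_boot all_order all_algebra.
From mathcomp Require Import boolp classical_sets reals convex.

Set Implicit Arguments.
Unset Strict Implicit.
Unset Printing Implicit Defensive.

Import Order.TTheory GRing.Theory Num.Theory.

Local Open Scope classical_set_scope.
Local Open Scope ring_scope.

Definition affine_set (R : realType) (E : lmodType R) (A : set E) : Prop :=
  forall (x y : E) (t : R), A x -> A y -> A (t *: x + (1 - t) *: y).

Definition affine_hull (R : realType) (E : lmodType R) (S : set E) : set E :=
  smallest (@affine_set R E) S.

Definition convex_hull (R : realType) (E : lmodType R) (S : set E) : set E :=
  smallest (@convex_set R E) S.

Definition translate (R : realType) (E : vectType R) (x : E) (U : {vspace E}) :
  set E := [set x + u | u in [set u : E | u \in U]].

(* The affine hull of a nonempty set is a translate of a linear subspace, whose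
   dimension does not depend on the representation (affine_dimP); the default
   value -1 is the dimension of the empty set. *)
Definition affine_dim (R : realType) (E : vectType R) (S : set E) : int :=
  xget (-1) [set d : int | exists (x : E) (U : {vspace E}),
    affine_hull S = translate x U /\ d = (\dim U)%:Z].

Definition full_dimensional (R : realType) (N : nat) (P : set 'cV[R]_N) : Prop :=
  affine_dim P = N%:Z.

Definition le_cV (R : realType) (n : nat) (x y : 'cV[R]_n) : Prop :=
  forall i : 'I_n, x i 0 <= y i 0.

Definition binary (R : realType) (n : nat) (x : 'cV[R]_n) : Prop :=
  forall i : 'I_n, x i 0 = 0 \/ x i 0 = 1.

Definition ones (R : realType) (n : nat) : 'cV[R]_n := const_mx 1.

Definition feasible (R : realType) (m n : nat) (A : 'M[R]_(m, n))
    (b : 'cV[R]_m) : set 'cV[R]_n :=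
  [set x | binary x /\ le_cV (A *m x) b].

Definition BP_polytope (R : realType) (m n : nat) (A : 'M[R]_(m, n))
    (b : 'cV[R]_m) : set 'cV[R]_n :=
  convex_hull (feasible A b).

Definition diameter_feasible (R : realType) (m n : nat) (A : 'M[R]_(m, n))
    (b : 'cV[R]_m) : set 'cV[R]_(n + (n + n)) :=
  [set w | exists x y z : 'cV[R]_n,
     [/\ w = col_mx x (col_mx y z), binary w,
         le_cV (A *m x) b, le_cV (A *m y) b
       & le_cV (x + y - z) (ones R n)]].

Definition diameter_polytope (R : realType) (m n : nat) (A : 'M[R]_(m, n))
    (b : 'cV[R]_m) : set 'cV[R]_(n + (n + n)) :=
  convex_hull (diameter_feasible A b).

Lemma translate_sub (R : realType) (E : vectType R) (x y : E)
    (U V : {vspace E}) :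
  translate x U = translate y V -> (U <= V)%VS.
Proof.
move=> eqUV.
have inV (u : E) : u \in U -> exists2 v, v \in V & y + v = x + u.
  move=> uU; have [v vV e] : translate y V (x + u) by rewrite -eqUV; exists u.
  by exists v.
apply/subvP => u uU.
have [v0 v0V e0] := inV 0 (mem0v U).
have [v1 v1V e1] := inV u uU.
have -> : u = v1 - v0.
  rewrite addr0 in e0.
  by apply: (addrI x); rewrite -e1 -e0 addrACA subrr addr0.
by rewrite memvB.
Qed.

Lemma affine_dimP (R : realType) (E : vectType R) (S : set E) (x : E)
    (U : {vspace E}) :
  affine_hull S = translate x U -> affine_dim S = (\dim U)%:Z.
Proof.
move=> hS; apply: xget_unique; first by exists x, U.
move=> d [y [V [hV ->]]].
have eqVU : translate y V = translate x U by rewrite -hV -hS.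
congr (Posz (\dim _)); apply/eqP; rewrite eqEsubv.
by rewrite (translate_sub eqVU) (translate_sub (esym eqVU)).
Qed.

(* Main.v *)
Require Import Defs.
From mathcomp Require Import all_boot all_order all_algebra.
From mathcomp Require Import boolp classical_sets reals convex.
From mathcomp Require Import ring.

(** It suffices to show that an affine set [H] containing all the points
    [x (+) y (+) z] of the diameter program is the whole space.  Full
    dimensionality of the polytope of the binary program serves as an induction
    principle, [full_dimensional_affine_ind]: an affine set containing every
    feasible point contains every point.

    Taking [z = e] makes the constraint [x + y - z <= e] void, so that [H]
    contains [x (+) y (+) e] for all feasible [x] and [y], whence, by the
    principle applied in [x] and then in [y], for all vectors [x] and [y].
    Taking [x = xbar] and [y = ybar] makes the constraint hold for every binary
    [z].  Feasible points are binary, so that the principle applies to [z] as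
    well, and [H] contains [xbar (+) ybar (+) z] for all vectors [z].  These two
    affine subspaces, of dimensions [2n] and [n], meet at
    [xbar (+) ybar (+) e] and have complementary directions: any point is an
    affine combination of a point of each. *)

Set Implicit Arguments.
Unset Strict Implicit.
Unset Printing Implicit Defensive.

Import Order.TTheory GRing.Theory Num.Theory.

Local Open Scope classical_set_scope.
Local Open Scope ring_scope.

(** * Affine hulls and dimension *)

Lemma affine_set_convex (R : realType) (E : lmodType R) (S : set E) :
  affine_set S -> convex_set S.
Proof. by move=> aS x y l; rewrite !inE; apply: aS. Qed.

Lemma affine_hull_affine (R : realType) (E : lmodType R) (S : set E) :
  affine_set (affine_hull S).
Proof.
move=> x y t Sx Sy H HS; case: (HS) => aH _.
exact: aH (Sx _ HS) (Sy _ HS).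
Qed.

Lemma sub_convex_affine_set (R : realType) (E : lmodType R) (S H : set E) :
  affine_set H -> S `<=` H -> convex_hull S `<=` H.
Proof. by move=> /affine_set_convex cH SH; apply: smallest_sub. Qed.

Lemma affine_dim_setT (R : realType) (N : nat) (S : set 'cV[R]_N) :
  affine_hull S = setT -> affine_dim S = N%:Z.
Proof.
move=> hS; rewrite (@affine_dimP _ _ S 0 fullv) ?dimvf ?/dim /= ?muln1 //.
rewrite hS; apply/esym/seteqP; split=> // x _.
by exists x; [exact: memvf | rewrite add0r].
Qed.

Lemma full_dimensional_affine_hull (R : realType) (N : nat)
    (S : set 'cV[R]_N) :
  full_dimensional S -> affine_hull S = setT.
Proof.
rewrite /full_dimensional /affine_dim; set D := (X in xget _ X).
(* The default value of the dimension is negative, hence it is not [N]. *)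
case: (xgetP (-1) D) => [d _ [x [U [-> ->]]] [dimU] | _ //].
have -> : U = fullv.
  by apply/eqP; rewrite eqEdim subvf dimvf dimU /dim /= muln1.
apply/seteqP; split=> // y _.
by exists (y - x); [exact: memvf | rewrite addrC subrK].
Qed.

(** Affine sets being convex, the affine hull of a convex hull lies in every
    affine set containing the points. *)
Lemma full_dimensional_affine_ind (R : realType) (N : nat)
    (S H : set 'cV[R]_N) :
  full_dimensional (convex_hull S) -> affine_set H -> S `<=` H ->
  forall x, H x.
Proof.
move=> /full_dimensional_affine_hull hT aH SH x.
have: affine_hull (convex_hull S) x by rewrite hT.
by apply: smallest_sub => //; apply: sub_convex_affine_set.
Qed.

(** Sections of an affine set along an affine map are affine; the maps needed
    insert a block into a column vector. *)
Lemma affine_set_preimage (R : realType) (E F : lmodType R) (f : E -> F)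
    (H : set F) :
  (forall x y t, f (t *: x + (1 - t) *: y) = t *: f x + (1 - t) *: f y) ->
  affine_set H -> affine_set (f @^-1` H).
Proof. by move=> fE aH x y t Hx Hy; rewrite /preimage /= fE; apply: aH. Qed.

Lemma scale_affine_id (R : realType) (E : lmodType R) (t : R) (x : E) :
  t *: x + (1 - t) *: x = x.
Proof. by rewrite -scalerDl addrC subrK scale1r. Qed.

(** * The diameter program *)

Lemma binary_col_mx (R : realType) (p q : nat) (u : 'cV[R]_p) (v : 'cV[R]_q) :
  binary u -> binary v -> binary (col_mx u v).
Proof. by move=> bu bv i; rewrite mxE; case: split => j. Qed.

Lemma binary_ones (R : realType) (n : nat) : binary (ones R n).
Proof. by move=> i; right; rewrite mxE. Qed.

Lemma binary_itv (R : realType) (n : nat) (x : 'cV[R]_n) (i : 'I_n) :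
  binary x -> 0 <= x i 0 <= 1.
Proof. by move=> /(_ i) [] ->; rewrite ?lexx ?ler01. Qed.

Section DiameterAffine.

Context (R : realType) (m n : nat) (A : 'M[R]_(m, n)) (b : 'cV[R]_m).
Implicit Types x y z : 'cV[R]_n.

Lemma diameter_feasible_col x y z :
  feasible A b x -> feasible A b y -> binary z ->
  le_cV (x + y - z) (ones R n) ->
  diameter_feasible A b (col_mx x (col_mx y z)).
Proof.
move=> [bx Ax] [by_ Ay] bz xyz; exists x, y, z; split=> //.
by do 2?apply: binary_col_mx.
Qed.

Lemma diameter_feasible_ones x y :
  feasible A b x -> feasible A b y ->
  diameter_feasible A b (col_mx x (col_mx y (ones R n))).
Proof.
move=> fx fy; apply: diameter_feasible_col => //; first exact: binary_ones.
move=> i; rewrite !mxE lerBlDr lerD //.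
  by case: fx => /(binary_itv i)/andP[].
by case: fy => /(binary_itv i)/andP[].
Qed.

Lemma diameter_feasible_disjoint x y z :
  feasible A b x -> feasible A b y -> le_cV (x + y) (ones R n) -> binary z ->
  diameter_feasible A b (col_mx x (col_mx y z)).
Proof.
move=> fx fy xy bz; apply: diameter_feasible_col => // i.
apply: le_trans (xy i); rewrite mxE [X in _ + X]mxE gerBl.
by case/andP: (binary_itv i bz).
Qed.

(** The constraint [x + y - z <= e] couples the three blocks, so that the
    feasible set is not a product; it contains the products
    [Fes x Fes x {e}] and [{xbar} x {ybar} x {0,1}^n], and these suffice. *)
Lemma affine_set_diameter (H : set 'cV[R]_(n + (n + n))) xbar ybar :
  full_dimensional (BP_polytope A b) ->
  feasible A b xbar -> feasible A b ybar -> le_cV (xbar + ybar) (ones R n) ->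
  affine_set H -> diameter_feasible A b `<=` H -> H = setT.
Proof.
move=> hfull fx fy xy aH DH.
have ind := full_dimensional_affine_ind hfull.
have Hxy x y : H (col_mx x (col_mx y (ones R n))).
  (* The principle frees one block at a time: [x] becomes arbitrary while [y]
     is still feasible, and then [y] in its turn. *)
  apply: (ind (fun y => H (col_mx x (col_mx y (ones R n))))) => [|{}y fy'].
    apply: affine_set_preimage aH => u v t.
    by rewrite !scale_col_mx !add_col_mx !scale_affine_id.
  apply: (ind (fun x => H (col_mx x (col_mx y (ones R n))))) => [|{}x fx'].
    apply: affine_set_preimage aH => u v t.
    by rewrite !scale_col_mx !add_col_mx !scale_affine_id.
  exact/DH/diameter_feasible_ones.
have Hz z : H (col_mx xbar (col_mx ybar z)).
  apply: (ind (fun z => H (col_mx xbar (col_mx ybar z)))) => [|{}z [bz _]].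
    apply: affine_set_preimage aH => u v t.
    by rewrite !scale_col_mx !add_col_mx !scale_affine_id.
  exact/DH/diameter_feasible_disjoint.
apply/seteqP; split=> // w _.
rewrite -[w]vsubmxK -[dsubmx w]vsubmxK.
set x := usubmx w; set y := usubmx _; set z := dsubmx _.
(* The midpoint of [x (+) y (+) z] and [xbar (+) ybar (+) z'] lies in the
   first subspace when [z'] is the reflection of [z] in [e]; extrapolating by
   the factor 2 recovers the given point. *)
have := aH _ _ 2 (Hxy (2^-1 *: (x + xbar)) (2^-1 *: (y + ybar)))
  (Hz (2 *: ones R n - z)).
rewrite !scale_col_mx !add_col_mx; congr (H (col_mx _ (col_mx _ _)));
  by apply/matrixP => i j; rewrite !mxE; field.
Qed.

End DiameterAffine.

Theorem corollary2p8 (R : realType) (m n : nat) (A : 'M[R]_(m, n))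
    (b : 'cV[R]_m)
    (hxy : exists xbar ybar : 'cV[R]_n,
       [/\ feasible A b xbar, feasible A b ybar
         & le_cV (xbar + ybar) (ones R n)])
    (hfull : full_dimensional (BP_polytope A b)) :
  full_dimensional (diameter_polytope A b) /\
  affine_dim (diameter_polytope A b) = Posz (3 * n)%N.
Proof.
case: hxy => xbar [ybar [fx fy xy]].
have hfd : full_dimensional (diameter_polytope A b).
  apply: affine_dim_setT.
  apply: (affine_set_diameter hfull fx fy xy); first exact: affine_hull_affine.
  apply: subset_trans (@sub_gen_smallest _ (@affine_set _ _) _).
  exact: sub_gen_smallest.
by split=> //; rewrite hfd !mulSn mul0n addn0.
Qed.
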